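(* Let $A\subset\mathbb{R}^n$ be a nonempty and closed set, and let $r>0$. Then $A$ is $r$-strongly convex if and only if $A$ is convex and $r$-spherically supported.
   Context: $\|\cdot\|$ and $\langle\cdot,\cdot\rangle$ are the Euclidean norm and inner product on $\mathbb{R}^n$; $\overline{B}(y;\rho)$ is the closed ball of radius $\rho$ centered at $y$; $\operatorname{bdry}A$ is the topological boundary of $A$. Proximal normal cone: for $A$ nonempty and closed and $a\in A$, $N_A^P(a):=\{\zeta\in\mathbb{R}^n : \exists\,\sigma\ge 0,\ \langle\zeta,x-a\rangle\le\sigma\|x-a\|^2\ \text{for all }x\in A\}$. $r$-strongly convex: $A$ is the intersection of closed balls of the same radius $r>0$. $r$-spherically supported: for every $a\in\operatorname{bdry}A$ there exists a nonzero $\zeta_a\in N_A^P(a)$ such that $\left\langle\frac{\zeta_a}{\|\zeta_a\|},x-a\right\rangle\le-\frac{1}{2r}\|x-a\|^2$ for all $x\in A$; equivalently, $A\subset\overline{B}\left(a-r\frac{\zeta_a}{\|\zeta_a\|};r\right)$. *)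

(* Defs.v *)
From HB Require Import structures.
From mathcomp Require Import all_boot all_order all_algebra.
From mathcomp Require Import all_classical all_reals all_analysis.

Set Implicit Arguments.
Unset Strict Implicit.
Unset Printing Implicit Defensive.

Import Order.TTheory GRing.Theory Num.Theory.
Import numFieldNormedType.Exports.

Local Open Scope classical_set_scope.
Local Open Scope ring_scope.

(* The library norm `|x| on 'rV[R]_n is the sup norm, hence the explicit
   Euclidean norm and balls below; the topology on 'rV[R]_n (used for closed,
   closure and interior) is the usual one. *)
Definition dotv (R : realType) (n : nat) (u v : 'rV[R]_n) : R :=
  \sum_(i < n) u ord0 i * v ord0 i.

Definition enorm (R : realType) (n : nat) (u : 'rV[R]_n) : R :=
  Num.sqrt (dotv u u).

Definition eclosed_ball (R : realType) (n : nat) (y : 'rV[R]_n) (rho : R) :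
    set 'rV[R]_n :=
  [set x | enorm (x - y) <= rho].

Definition bdry (T : topologicalType) (A : set T) : set T :=
  closure A `\` interior A.

Definition proximal_normal_cone (R : realType) (n : nat) (A : set 'rV[R]_n)
    (a : 'rV[R]_n) : set 'rV[R]_n :=
  [set zeta | exists2 sigma : R, 0 <= sigma &
     forall x, A x -> dotv zeta (x - a) <= sigma * enorm (x - a) ^+ 2].

(* The family of balls is indexed by the set C of their centers. C may be empty
   (then A is the whole space), which is needed for the equivalence: the whole
   space is convex and, having empty boundary, is r-spherically supported. *)
Definition strongly_convex (R : realType) (n : nat) (r : R)
    (A : set 'rV[R]_n) : Prop :=
  exists C : set 'rV[R]_n, A = \bigcap_(c in C) eclosed_ball c r.

Definition spherically_supported (R : realType) (n : nat) (r : R)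
    (A : set 'rV[R]_n) : Prop :=
  forall a, bdry A a ->
    exists zeta : 'rV[R]_n,
      [/\ proximal_normal_cone A a zeta, zeta <> 0 &
          forall x, A x ->
            dotv ((enorm zeta)^-1 *: zeta) (x - a)
              <= - (1 / (2 * r)) * enorm (x - a) ^+ 2].

(* Main.v *)
Require Import Defs.
From mathcomp Require Import all_boot all_order all_algebra.
From mathcomp Require Import all_classical all_reals all_analysis.
From mathcomp Require Import ring lra.
Import Order.TTheory GRing.Theory Num.Theory.
Import numFieldNormedType.Exports.
Local Open Scope classical_set_scope.
Local Open Scope ring_scope.

(* A unit vector w supports A at a with constant 1/(2r) iff A lies in the ball
   of radius r centered at a - r w, which touches a.

   If A is an intersection of balls of radius r and a is a boundary point, the
   set of centers c with A contained in B(c; r) is compact; if a were at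
   distance < r from all of them, so would be all points near a, making a an
   interior point. So some such ball touches a, and a - c is the wanted normal.

   Conversely, let x lie outside A. If A has two points, the strict support
   inequality forces their midpoint b into the interior of A; the segment from b
   to x meets the boundary at some a distinct from b and x, and the support ball
   at a contains A while x, being beyond a on the ray from b, lies outside it.
   If A is a single point u, take the ball touching u with outer normal x - u. *)

Set Implicit Arguments.
Unset Strict Implicit.
Unset Printing Implicit Defensive.

(* Stated for an abstract V because on 'rV[R]_n unification unfolds the
   neighborhood filter and then finds no Filter instance. *)
Lemma continuous_subr (R : realType) (V : normedModType R) (y : V) :
  continuous (fun x => y - x).
Proof. by move=> c; apply: cvgB; [exact: cvg_cst|exact: cvg_id]. Qed.

Section euclidean.
Context {R : realType} {n : nat}.
Implicit Types (u v w x y a b c : 'rV[R]_n) (k r : R).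

(** * Algebra of the Euclidean inner product *)

Lemma dotvC u v : dotv u v = dotv v u.
Proof. by apply: eq_bigr => i _; rewrite mulrC. Qed.

Lemma dotvDl u v w : dotv (u + v) w = dotv u w + dotv v w.
Proof. by rewrite -big_split; apply: eq_bigr => i _; rewrite mxE mulrDl. Qed.

Lemma dotvZl k u w : dotv (k *: u) w = k * dotv u w.
Proof. by rewrite mulr_sumr; apply: eq_bigr => i _; rewrite mxE mulrA. Qed.

Lemma dotvNl u w : dotv (- u) w = - dotv u w.
Proof. by rewrite -scaleN1r dotvZl mulN1r. Qed.

Lemma dotvDr u v w : dotv w (u + v) = dotv w u + dotv w v.
Proof. by rewrite dotvC dotvDl !(dotvC w). Qed.

Lemma dotvZr k u w : dotv w (k *: u) = k * dotv w u.
Proof. by rewrite dotvC dotvZl dotvC. Qed.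

Lemma dotvNr u w : dotv w (- u) = - dotv w u.
Proof. by rewrite dotvC dotvNl dotvC. Qed.

Definition dotvE := (dotvDl, dotvDr, dotvZl, dotvZr, dotvNl, dotvNr).

Lemma dotv_ge0 u : 0 <= dotv u u.
Proof. by apply: sumr_ge0 => i _; rewrite -expr2 sqr_ge0. Qed.

Lemma sqr_coord_le_dotv u i : u ord0 i ^+ 2 <= dotv u u.
Proof.
rewrite /dotv (bigD1 i) //= -expr2 lerDl.
by apply: sumr_ge0 => j _; rewrite -expr2 sqr_ge0.
Qed.

Lemma dotv_gt0 u : u != 0 -> 0 < dotv u u.
Proof.
move=> u0; rewrite lt_neqAle dotv_ge0 andbT eq_sym.
apply: contra u0 => /eqP uu0.
apply/eqP/rowP => i; rewrite mxE; apply/eqP.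
by rewrite -sqrf_eq0 eq_le sqr_ge0 -uu0 sqr_coord_le_dotv.
Qed.

Lemma enorm_sqr u : enorm u ^+ 2 = dotv u u.
Proof. by rewrite sqr_sqrtr// dotv_ge0. Qed.

Lemma enorm_gt0 u : u != 0 -> 0 < enorm u.
Proof. by move=> u0; rewrite sqrtr_gt0 dotv_gt0. Qed.

Lemma dotv_normalize u : u != 0 ->
  dotv ((enorm u)^-1 *: u) ((enorm u)^-1 *: u) = 1.
Proof.
move=> /enorm_gt0/lt0r_neq0 u0; rewrite dotvZl dotvZr -enorm_sqr.
by field.
Qed.

Lemma eclosed_ballE c r x : 0 <= r ->
  eclosed_ball c r x <-> dotv (x - c) (x - c) <= r ^+ 2.
Proof. by move=> r0; rewrite -enorm_sqr ler_sqr// nnegrE sqrtr_ge0. Qed.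

(** * Balls and the support inequality *)

Lemma convex_eclosed_ball c r : 0 <= r -> convex_set (eclosed_ball c r).
Proof.
move=> r0 x y k; rewrite !inE => /(eclosed_ballE _ _ r0) xr.
move=> /(eclosed_ballE _ _ r0) yr; apply/(eclosed_ballE _ _ r0).
rewrite [conv k x y](_ : _ =
  k%:num *: (x : 'rV[R]_n) + (1 - k%:num) *: (y : 'rV[R]_n)) //.
have k0 : 0 <= k%:num by [].
have k1 : 0 <= 1 - k%:num by rewrite subr_ge0.
move: (k%:num) k0 k1 => t t0 t1.
have -> : t *: x + (1 - t) *: y - c = t *: (x - c) + (1 - t) *: (y - c).
  by apply/rowP => i; rewrite !mxE; ring.
move: (x - c) (y - c) xr yr => u v ur vr.
(* Convexity of the squared norm: t|u|^2 + (1-t)|v|^2 exceeds |tu + (1-t)v|^2 by exactly t(1-t)|u -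
   v|^2. *)
have uv := dotv_ge0 (u - v).
have := mulr_ge0 (mulr_ge0 t0 t1) uv.
have := ler_wpM2l t0 ur; have := ler_wpM2l t1 vr.
by rewrite !dotvE (dotvC v u); nra.
Qed.

(** Expanding |(y - a) + r w|^2 <= r^2 with |w| = 1, the terms r^2 cancel; dividing by 2r gives the
    support inequality. *)
Lemma mem_support_ball a w r y : 0 < r -> dotv w w = 1 ->
  eclosed_ball (a - r *: w) r y <->
  dotv w (y - a) <= - (1 / (2 * r)) * enorm (y - a) ^+ 2.
Proof.
move=> r0 w1; apply: (iff_trans (eclosed_ballE _ _ (ltW r0))).
rewrite enorm_sqr.
have -> : y - (a - r *: w) = (y - a) + r *: w.
  by apply/rowP => i; rewrite !mxE; ring.
move: (y - a) => u; rewrite !dotvE w1 (dotvC u w).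
have r2 : 0 < 2 * r by rewrite mulr_gt0.
rewrite -(ler_pM2l r2 (dotv w u)).
have -> : 2 * r * (- (1 / (2 * r)) * dotv u u) = - dotv u u.
  by field; rewrite gt_eqF.
by split; lra.
Qed.

Lemma not_mem_support_ball a w r x : 0 < r -> dotv w w = 1 ->
  0 < dotv w (x - a) -> ~ eclosed_ball (a - r *: w) r x.
Proof.
move=> r0 w1 wx /(mem_support_ball _ _ r0 w1); apply/negP; rewrite -ltNge.
apply: le_lt_trans wx; rewrite mulNr oppr_le0 mulr_ge0 ?sqr_ge0//.
by rewrite divr_ge0// mulr_ge0// ltW.
Qed.

(** * Continuity, compactness and connectedness *)

Lemma cvg_dotv (T : Type) (F : set_system T) {FF : Filter F}
    (f g : T -> 'rV[R]_n) u v : f @ F --> u -> g @ F --> v ->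
  dotv (f t) (g t) @[t --> F] --> dotv u v.
Proof.
move=> fu gv; apply: cvg_big; first exact: add_continuous.
move=> i _; apply: cvgM.
  exact: (cvg_comp _ _ fu (@coord_continuous _ _ _ ord0 i u)).
exact: (cvg_comp _ _ gv (@coord_continuous _ _ _ ord0 i v)).
Qed.

Lemma compact_bounded_dist a r (K : set 'rV[R]_n) : 0 <= r ->
  closed K -> (forall c, K c -> dotv (a - c) (a - c) <= r ^+ 2) -> compact K.
Proof.
(* [K] is a closed subset of the cube of half-side [r] around [a]. *)
move=> r0 Kcl Kr; apply: (subclosed_compact Kcl).
  apply: (@rV_compact _ _ (fun i => `[a ord0 i - r, a ord0 i + r]%classic)).
  by move=> i; exact: segment_compact.
move=> c /Kr cr i /=; rewrite in_itv/= -ler_distlC.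
have := le_trans (sqr_coord_le_dotv (a - c) i) cr.
by rewrite -real_normK ?num_real// ler_sqr ?nnegrE// !mxE.
Qed.

(** If the segment missed the boundary, [A] and its interior would agree along it, so the parameters
    with [f t] in [A] would be nonempty, open and closed in [0, 1], hence all of it, although [f 1]
    is [x]. *)
Lemma segment_meets_bdry (A : set 'rV[R]_n) b x : closed A -> A b -> ~ A x ->
  exists2 t, 0 <= t <= 1 & bdry A (b + t *: (x - b)).
Proof.
move=> Acl Ab nAx; pose f t := b + t *: (x - b).
have fc : continuous f.
  by move=> t; apply: cvgD; [exact: cvg_cst|exact: scalel_continuous].
apply: contrapT => nbd.
have int t : `[0, 1]%classic t -> A (f t) -> A° (f t).
  move=> /= t01 At; apply: contrapT => nAt; apply: nbd; exists t.
    by move: t01; rewrite in_itv.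
  by split => //; exact: subset_closure.
suff : `[0, 1] `&` (f @^-1` A) = `[0%R, 1%R]%classic.
  move/seteqP => [_ /(_ 1)] /=; rewrite in_itv/= ler01 lexx => /(_ isT)[_].
  by rewrite /f scale1r addrC subrK.
apply: segment_connected.
- by exists 0; split; rewrite /= ?in_itv/= ?lexx ?ler01// /f scale0r addr0.
- exists (f @^-1` A°).
    by apply: open_comp => [? _|]; [exact: fc|exact: open_interior].
  apply/seteqP; split => t [t01 At]; split => //; first exact: int.
  exact: (interior_subset At).
- by exists (f @^-1` A) => //; apply: preimage_closed => // ? _; exact: fc.
Qed.

(** * From spherical support to separating balls *)

Lemma midpoint_interior (A : set 'rV[R]_n) r u v : 0 < r -> closed A ->
  convex_set A -> spherically_supported r A -> A u -> A v -> u != v ->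
  A° (2^-1 *: (u + v)).
Proof.
move=> r0 Acl Acv Ass Au Av uv; set b := 2^-1 *: (u + v).
have Ab : A b.
  have h0 : 0 <= 2^-1 :> R by lra.
  have h1 : 2^-1 <= 1 :> R by lra.
  have := Acv u v (Itv01 h0 h1); rewrite !inE => /(_ Au Av).
  rewrite [conv _ _ _](_ : _ = 2^-1 *: u + (1 - 2^-1) *: v) //.
  suff -> : 2^-1 *: u + (1 - 2^-1) *: v = b by [].
  by apply/rowP => i; rewrite !mxE; field.
apply: contrapT => nAb.
have [|z [_ /eqP z0 zA]] := Ass b.
  by split => //; exact: subset_closure.
(* As [u - b] and [v - b] are opposite, adding their support inequalities bounds 0 by a negative
   number. *)
have := zA _ Au; have := zA _ Av.
have -> : v - b = 2^-1 *: (v - u) by apply/rowP => i; rewrite !mxE; field.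
have -> : u - b = - (2^-1 *: (v - u)) by apply/rowP => i; rewrite !mxE; field.
have h : 0 < 1 / (2 * r) by rewrite divr_gt0// mulr_gt0.
have d : 0 < dotv (2^-1 *: (v - u)) (2^-1 *: (v - u)).
  apply: dotv_gt0.
  by rewrite scaler_eq0 invr_eq0 pnatr_eq0 orFb subr_eq0 eq_sym.
have := mulr_gt0 h d.
by rewrite !enorm_sqr; set w := 2^-1 *: _; rewrite !(dotvNr, dotvNl); lra.
Qed.

Lemma exists_separating_ball (A : set 'rV[R]_n) r x : 0 < r -> A !=set0 ->
  closed A -> convex_set A -> spherically_supported r A -> ~ A x ->
  exists2 c, A `<=` eclosed_ball c r & ~ eclosed_ball c r x.
Proof.
move=> r0 [u Au] Acl Acv Ass nAx.
(* A singleton is its own boundary and its support vectors may point in any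
   direction, so the separating ball has to be chosen by hand. *)
have [[v [Av uv]]|Asing] := pselect (exists v, A v /\ u != v); last first.
  have xu : x - u != 0 by rewrite subr_eq0; apply: contra_notN nAx => /eqP ->.
  have w1 := dotv_normalize xu.
  exists (u - r *: ((enorm (x - u))^-1 *: (x - u))).
    move=> y Ay; have [<-|uy] := eqVneq u y; last by case: Asing; exists y.
    apply/(mem_support_ball _ _ r0 w1).
    by rewrite enorm_sqr subrr -(scale0r 0) !dotvZr !mul0r mulr0.
  apply: (not_mem_support_ball r0 w1).
  by rewrite dotvZl mulr_gt0 ?dotv_gt0// invr_gt0 enorm_gt0.
have Aib := midpoint_interior r0 Acl Acv Ass Au Av uv.
move: (2^-1 *: (u + v)) Aib => b Aib.
have Ab : A b by exact: interior_subset Aib.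
have [t /andP[t0 t1] at_] := segment_meets_bdry Acl Ab nAx.
have tgt0 : 0 < t.
  rewrite lt_neqAle t0 andbT; apply/eqP => t00; case: at_ => _.
  by rewrite -t00 scale0r addr0.
have tlt1 : t < 1.
  rewrite lt_neqAle t1 andbT; apply/eqP => t11; apply: nAx.
  have [+ _] := at_; rewrite t11 scale1r addrC subrK.
  by move=> /Acl.
have [z [_ /eqP z0 zA]] := Ass _ at_.
have w1 := dotv_normalize z0; move: (_ *: z) w1 zA => w w1 zA.
exists (b + t *: (x - b) - r *: w).
  by move=> y Ay; apply/(mem_support_ball _ _ r0 w1); exact: zA.
apply: (not_mem_support_ball r0 w1).
have -> : x - (b + t *: (x - b)) = (1 - t) *: (x - b).
  by apply/rowP => i; rewrite !mxE; ring.
rewrite dotvZr mulr_gt0 ?subr_gt0//.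
(* Seen from the boundary point, [b] and [x] lie in opposite directions; strict support at [b] makes
   [dotv w (x - b)] positive. *)
have /zA := Ab; have -> : b - (b + t *: (x - b)) = - (t *: (x - b)).
  by rewrite opprD addNKr.
have h : 0 < 1 / (2 * r) by rewrite divr_gt0// mulr_gt0.
have d : 0 < dotv (t *: (x - b)) (t *: (x - b)).
  apply: dotv_gt0; rewrite scaler_eq0 gt_eqF//= subr_eq0.
  by apply: contra_notN nAx => /eqP ->.
have hd := mulr_gt0 h d.
rewrite enorm_sqr dotvNr; rewrite dotvNl dotvNr dotvZr opprK => H.
have : 0 < t * dotv w (x - b) by lra.
by rewrite pmulr_rgt0.
Qed.

(** * From intersections of balls to spherical support *)

Lemma exists_touching_ball (A C : set 'rV[R]_n) r a : 0 < r ->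
  A = \bigcap_(c in C) eclosed_ball c r -> A a -> ~ A° a ->
  exists2 c, A `<=` eclosed_ball c r & dotv (a - c) (a - c) = r ^+ 2.
Proof.
move=> r0 AC Aa nAa; apply: contrapT => nc; apply: nAa.
(* [C] need not be closed; [K] contains it and is compact. *)
pose K := [set c | A `<=` eclosed_ball c r].
have Kcl : closed K.
  have -> : K = \bigcap_(y in A) [set c | dotv (y - c) (y - c) <= r ^+ 2].
    apply/seteqP; split => c Kc y /Kc; first by move/(eclosed_ballE _ _ (ltW r0)).
    by move=> ?; apply/(eclosed_ballE _ _ (ltW r0)).
  apply: closed_bigI => y _.
  apply: (@preimage_closed _ _ (fun c => dotv (y - c) (y - c))
    [set s | s <= r ^+ 2]).
    move=> c _; have yc := @continuous_subr _ _ y c.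
    exact: (cvg_dotv yc yc).
  exact: closed_le.
have Kle c : K c -> dotv (a - c) (a - c) <= r ^+ 2.
  by move=> /(_ _ Aa)/(eclosed_ballE _ _ (ltW r0)).
have Kco : compact K by apply: (compact_bounded_dist _ Kcl Kle); exact: ltW.
(* Compactness of [K] yields one neighborhood of [a] on which the strict inequality holds for all
   centers at once. *)
have nK : nbhs a [set x | K `<=` [set c | dotv (x - c) (x - c) < r ^+ 2]].
  apply: ((compact_near_coveringP K).1 Kco _ (nbhs a)
    (fun x c => dotv (x - c) (x - c) < r ^+ 2) (nbhs_filter a)) => c Kc.
  have ac : dotv (a - c) (a - c) < r ^+ 2.
    by rewrite lt_neqAle Kle// andbT; apply/eqP => ?; apply: nc; exists c.
  have pc := @sub_continuous 'rV[R]_n (a, c).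
  have /= := @cvgr_lt _ _ _ _ _ _ (cvg_dotv pc pc) _ ac.
  case=> -[U V] [/= Ua Vc] UV; exists (V, U) => // -[c' x] [/= Vc' Ux].
  exact: (UV (x, c')).
apply: (@filterS _ _ (nbhs_filter a) _ _ _ nK) => x Kx; rewrite AC => c Cc.
apply/(eclosed_ballE _ _ (ltW r0))/ltW/Kx => y.
by rewrite AC; exact.
Qed.

Lemma strongly_convex_supported (A : set 'rV[R]_n) r : 0 < r -> closed A ->
  strongly_convex r A -> spherically_supported r A.
Proof.
move=> r0 Acl [C AC] a [/Acl Aa nAa].
have [c Ac ac] := exists_touching_ball r0 AC Aa nAa.
have rn0 := lt0r_neq0 r0.
have ne : enorm (a - c) = r by rewrite /enorm ac sqrtr_sqr gtr0_norm.
have Asup y : A y ->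
    dotv ((enorm (a - c))^-1 *: (a - c)) (y - a)
      <= - (1 / (2 * r)) * enorm (y - a) ^+ 2.
  move=> /Ac Ay; apply/mem_support_ball => //.
    by rewrite ne dotvZl dotvZr ac; field.
  by rewrite ne scalerA divff// scale1r subKr.
exists (a - c); split.
(* The support inequality has a nonpositive right-hand side, so sigma = 0 suffices. *)
- exists 0 => // y /Asup; rewrite ne dotvZl mul0r => H.
  have : r^-1 * dotv (a - c) (y - a) <= 0.
    apply: (le_trans H); rewrite mulNr oppr_le0 mulr_ge0 ?sqr_ge0//.
    by rewrite divr_ge0// mulr_ge0// ltW.
  by rewrite pmulr_rle0// invr_gt0.
- move=> ac0; move: ac; rewrite ac0 -(scale0r 0) dotvZl mul0r => /esym/eqP.
  by rewrite sqrf_eq0 (negbTE rn0).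
- exact: Asup.
Qed.

Lemma strongly_convex_convex (A : set 'rV[R]_n) r : 0 < r ->
  strongly_convex r A -> convex_set A.
Proof.
move=> r0 [C ->] x y k; rewrite !inE => Ax Ay c Cc.
have := @convex_eclosed_ball c r (ltW r0) x y k.
by rewrite !inE; apply; [exact: Ax|exact: Ay].
Qed.

End euclidean.

Theorem corollary1p3 (R : realType) (n : nat) (A : set 'rV[R]_n) (r : R)
    (A0 : A !=set0) (Acl : closed A) (r0 : 0 < r) :
  strongly_convex r A <-> convex_set A /\ spherically_supported r A.
Proof.
split=> [Asc|[Acv Ass]].
  split; first exact: strongly_convex_convex Asc.
  exact: strongly_convex_supported.
(* The largest possible family: every ball of radius [r] that contains [A]. *)
exists [set c | A `<=` eclosed_ball c r].
apply/seteqP; split => [x Ax c|x Bx]; first exact.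
apply: contrapT => nAx.
have [c Ac] := exists_separating_ball r0 A0 Acl Acv Ass nAx.
by apply; exact: Bx.
Qed.
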